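(* Let $D\geq 1$ and $k\geq 1$ be integers and let $p\in[0,1]$. Then the capacity of the $D$-dimensional (cyclic) $(0,k,p)$-RLL semiconstrained system satisfies $$C_{k,p}^{(D)}\geq 1+D\left(C_{k,p/D}^{(1)}-1\right).$$
   Context: Let $[n]=\{0,1,\dots,n-1\}$ and let $e_0,\dots,e_{D-1}$ be the standard unit vectors of $\mathbb{Z}^D$. For an array $\omega\in\{0,1\}^{[n]^D}$, an index $i\in[n]^D$, a length $m$ and a direction $j$, let $\omega_{i,m,e_j}=\omega_{i}\,\omega_{i+e_j}\cdots\omega_{i+(m-1)e_j}$, a one-dimensional word of length $m$, with coordinates of indices taken modulo $n$. For a finite binary word $\tau$ define the cyclic frequency $$T^{\mathrm{cyc}}(\tau,\omega)=\frac{1}{n^D}\sum_{j=0}^{D-1}\ \#\{i\in[n]^D : \omega_{i,|\tau|,e_j}=\tau\}.$$ Let $1^{k+1}$ be the word of $k+1$ ones. The $D$-dimensional cyclic $(0,k,p)$-RLL semiconstrained system is $\bigcup_n \mathcal{B}_n^{\mathrm{cyc},(D)}$, where $\mathcal{B}_n^{\mathrm{cyc},(D)}=\{\omega\in\{0,1\}^{[n]^D}: T^{\mathrm{cyc}}(1^{k+1},\omega)\leq p\}$, and its capacity is $$C^{(D)}_{k,p}=\limsup_{n\to\infty}\frac{1}{n^D}\log_2\left|\mathcal{B}_n^{\mathrm{cyc},(D)}\right|.$$ $C^{(1)}_{k,p/D}$ is the case of dimension $1$ with $p$ replaced by $p/D$. *)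

(* Defs.v *)
From HB Require Import structures.
From mathcomp Require Import all_boot all_order all_algebra.
From mathcomp Require Import boolp classical_sets reals ereal topology.
From mathcomp Require Import normedtype sequences exp.

Set Implicit Arguments.
Unset Strict Implicit.
Unset Printing Implicit Defensive.

Import Order.TTheory GRing.Theory Num.Theory.
Local Open Scope ring_scope.

Definition site (D n : nat) := {ffun 'I_D -> 'I_n}.

Definition array (D n : nat) := {ffun site D n -> bool}.

Lemma cyc_add_subproof (n : nat) (a : 'I_n) (t : nat) : ((a + t) %% n < n)%N.
Proof. by rewrite ltn_mod (leq_ltn_trans _ (ltn_ord a)). Qed.

Definition cyc_add (n : nat) (a : 'I_n) (t : nat) : 'I_n :=
  Ordinal (cyc_add_subproof a t).

(* i + t e_j, coordinates taken modulo n *)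
Definition shift (D n : nat) (i : site D n) (j : 'I_D) (t : nat) : site D n :=
  [ffun l => if l == j then cyc_add (i l) t else i l].

(* omega_{i, m, e_j}; the word wraps around (possibly several times if m > n) *)
Definition subword (D n : nat) (omega : array D n) (i : site D n) (m : nat)
    (j : 'I_D) : seq bool :=
  mkseq (fun t => omega (shift i j t)) m.

Definition Tcyc (R : realType) (D n : nat) (tau : seq bool)
    (omega : array D n) : R :=
  (\sum_(j < D) #|[set i : site D n | subword omega i (size tau) j == tau]|)%:R
  / (n ^ D)%:R.

Definition Bcyc (R : realType) (D k : nat) (p : R) (n : nat) :
    {set array D n} :=
  [set omega : array D n | Tcyc R (nseq k.+1 true) omega <= p].

Definition log2 (R : realType) (x : R) : R := ln x / ln 2.

(* The limsup is taken in the extended reals.  For 0 <= p the all-zero array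
   lies in every Bcyc, so the logarithm is that of a positive number. *)
Definition capacity (R : realType) (D k : nat) (p : R) : \bar R :=
  limn_esup (fun n : nat =>
    (log2 (#|Bcyc D k p n|%:R : R) / (n ^ D)%:R)%:E).

(* Main.v *)
(** Zeroing entries of an array only destroys occurrences of [1^(k+1)], so the
    set of arrays whose restriction to a given axis-parallel line lies in the
    one-dimensional system with parameter [p/D] is down-closed.  By Harris'
    inequality, under the uniform measure the events attached to the
    [D n^(D-1)] lines are positively correlated, so the probability that all of
    them hold is at least [(|B_n| / 2^n)^(D n^(D-1))], where [B_n] is the
    one-dimensional system.  An array satisfying all of them has frequency at
    most [p/D] in each direction, hence at most [p] in total. *)

Require Import Defs.
From mathcomp Require Import all_boot all_order all_algebra.
From mathcomp Require Import reals ereal.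
From mathcomp Require Import classical_sets topology normedtype sequences exp.
From mathcomp Require Import fintype finset.
From mathcomp Require Import zify ring.

Import Order.TTheory GRing.Theory Num.Theory.

Local Open Scope nat_scope.

(** The right side minus the left is [(a0 - a1) * (b0 - b1)]. *)
Lemma chebyshev2 a0 a1 b0 b1 : a1 <= a0 -> b1 <= b0 ->
  (a0 + a1) * (b0 + b1) <= (a0 * b0 + a1 * b1) * 2.
Proof. nia. Qed.

(** Induction on [#|S|]: a point [x] of [S] splits each family into the members avoiding [x] and
    those containing it. Down-closedness makes the second part the smaller one, so [chebyshev2]
    merges the two induction hypotheses, the factor 2 being absorbed by [2 ^ #|S|]. *)
Lemma kleitman_powerset (T : finType) (S : {set T}) (F G : {set {set T}}) :
    (forall X Y : {set T}, X \subset Y -> Y \in F -> X \in F) ->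
    (forall X Y : {set T}, X \subset Y -> Y \in G -> X \in G) ->
  #|F :&: powerset S| * #|G :&: powerset S|
    <= #|F :&: G :&: powerset S| * 2 ^ #|S|.
Proof.
have [m] := ubnP #|S|; elim: m => // m IH in S F G *; rewrite ltnS => leSm dF dG.
have [->|[x xS]] := set_0Vmem S.
  rewrite powerset0 cards0 expn0 muln1.
  have [F0|F0] := boolP (set0 \in F); last first.
    suff -> : F :&: [set set0] = set0 by rewrite cards0.
    by apply/setP => X; rewrite !inE; case: eqP => [->|]; rewrite ?(negPf F0) ?andbF.
  suff -> : F :&: G :&: [set set0] = G :&: [set set0].
    by rewrite -[leqRHS]mul1n leq_mul2r -(cards1 (@set0 T)) subset_leq_card ?orbT ?subsetIr.
  by apply/setP => X; rewrite !inE; case: eqP => [->|]; rewrite ?F0 ?andbF.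
(* The sets of [H] containing [x], with [x] removed; below [H] when [H] is
   down-closed. *)
pose link (H : {set {set T}}) := [set X : {set T} | x |: X \in H].
have dlink (H : {set {set T}}) : (forall X Y : {set T}, X \subset Y -> Y \in H -> X \in H) ->
    forall X Y : {set T}, X \subset Y -> Y \in link H -> X \in link H.
  by move=> dH X Y sXY; rewrite !inE; apply/dH/setUS.
have split (H : {set {set T}}) : #|H :&: powerset S| =
    #|H :&: powerset (S :\ x)| + #|link H :&: powerset (S :\ x)|.
  rewrite -(cardsID [set X : {set T} | x \in X] (H :&: powerset S)) addnC; congr addn.
    by apply: eq_card => X; rewrite !inE subsetD1; case: (x \in X); rewrite ?andbT ?andbF.
  have inj : {in link H :&: powerset (S :\ x) &, injective (fun X => x |: X)}.
    move=> X Y; rewrite !inE !subsetD1 => /and3P[_ _ xX] /and3P[_ _ xY] eqXY.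
    by rewrite -(setU1K xX) eqXY setU1K.
  rewrite -(card_in_imset inj); apply: eq_card => X; rewrite !inE.
  apply/idP/imsetP => [/andP[/andP[XH XS] xX]|[Y + ->]].
    by exists (X :\ x); rewrite ?setD1K // !inE setD1K // XH setSD.
  by rewrite !inE !subsetD1 subUset sub1set xS eqxx => /and3P[-> -> _].
have cS : #|S| = #|S :\ x|.+1 by rewrite (cardsD1 x S) xS.
have lt : #|S :\ x| < m by rewrite -cS.
have le (H : {set {set T}}) : (forall X Y : {set T}, X \subset Y -> Y \in H -> X \in H) ->
    #|link H :&: powerset (S :\ x)| <= #|H :&: powerset (S :\ x)|.
  move=> dH; apply/subset_leq_card/setSI/subsetP => X; rewrite inE.
  exact/dH/subsetUr.
have IH0 := IH _ F G lt dF dG.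
have IH1 := IH _ _ _ lt (dlink F dF) (dlink G dG).
rewrite !split (leq_trans (chebyshev2 _ _ _ _ (le F dF) (le G dG))) //.
rewrite cS expnSr mulnA leq_mul2r /= mulnDl leq_add //.
suff -> : link (F :&: G) = link F :&: link G by [].
by apply/setP => X; rewrite !inE.
Qed.

Definition down_closed {T : finType} (A : {set {ffun T -> bool}}) :=
  forall v w : {ffun T -> bool}, (forall x, v x -> w x) -> w \in A -> v \in A.

(** This is [kleitman_powerset] on the full power set, carried over by the indicator bijection
    [ind]. *)
Lemma harris (T : finType) (A B : {set {ffun T -> bool}}) :
  down_closed A -> down_closed B -> #|A| * #|B| <= #|A :&: B| * 2 ^ #|T|.
Proof.
move=> dA dB; pose ind (X : {set T}) : {ffun T -> bool} := [ffun x => x \in X].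
have cardE (C : {set {ffun T -> bool}}) : #|C| = #|ind @^-1: C :&: powerset setT|.
  have -> : ind @^-1: C :&: powerset setT = ind @^-1: C.
    by apply/setIidPl/subsetP => X _; rewrite inE subsetT.
  rewrite on_card_preimset //.
  exists (fun w : {ffun T -> bool} => [set x | w x]) => [X _|w _].
    by apply/setP => x; rewrite inE ffunE.
  by apply/ffunP => x; rewrite ffunE inE.
have down (C : {set {ffun T -> bool}}) : down_closed C ->
    forall X Y : {set T}, X \subset Y -> Y \in ind @^-1: C -> X \in ind @^-1: C.
  move=> dC X Y /subsetP sXY; rewrite !inE; apply: dC => x; rewrite !ffunE.
  exact: sXY.
rewrite !cardE preimsetI -cardsT.
by apply: kleitman_powerset; apply: down.
Qed.

(** The pulled-back event reads only the coordinates in the image of [f], so its density is at least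
    that of [B]; denominators are cleared. *)
Lemma card_pullback (S T : finType) (f : S -> T) (B : {set {ffun S -> bool}}) :
  injective f ->
  #|B| * 2 ^ #|T|
    <= #|[set w : {ffun T -> bool} | [ffun s => w (f s)] \in B]| * 2 ^ #|S|.
Proof.
move=> f_inj; set E := [set w | _].
pose over (w : {ffun T -> bool}) (b : {ffun S -> bool}) :=
  [ffun x => if [pick s | f s == x] is Some s then b s else w x].
have pickf s : [pick s' | f s' == f s] = Some s.
  by case: pickP => [s' /eqP/f_inj -> // | /(_ s)]; rewrite eqxx.
have overf w b s : over w b (f s) = b s by rewrite ffunE pickf.
(* Exchanging [b] with the values of [w] on the image of [f] loses no
   information and sends pairs with [b \in B] to pairs with first entry in [E]. *)
pose swap (c : {ffun S -> bool} * {ffun T -> bool}) :=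
  (over c.2 c.1, [ffun s => c.2 (f s)]).
have swap_inj : injective swap.
  move=> [b w] [b' w'] [/ffunP e1 /ffunP e2]; congr (_, _); apply/ffunP => x.
    by have := e1 (f x); rewrite !overf.
  have := e1 x; rewrite !ffunE; case: pickP => [s /eqP <- _|//].
  by have := e2 s; rewrite !ffunE.
have cE (U : finType) : 2 ^ #|U| = #|[set: {ffun U -> bool}]|.
  by rewrite cardsT card_ffun card_bool.
rewrite !cE -!cardsX -(card_imset _ swap_inj).
apply/subset_leq_card/subsetP => _ /imsetP[[b w] + ->].
rewrite !inE !andbT /= => bB.
by suff -> : [ffun s => over w b (f s)] = b by []; apply/ffunP => s; rewrite ffunE overf.
Qed.

(** Pullbacks of a down-closed set are down-closed, so [harris] adds one event at a time. The images
    of the [f i] may overlap: positive correlation stands in for independence. *)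
Lemma card_pullbacks (S T : finType) (I : eqType) (r : seq I) (f : I -> S -> T)
    (B : {set {ffun S -> bool}}) :
    (forall i, injective (f i)) -> down_closed B ->
  #|B| ^ size r * 2 ^ #|T|
    <= #|[set w : {ffun T -> bool} | all (fun i => [ffun s => w (f i s)] \in B) r]|
       * 2 ^ (#|S| * size r).
Proof.
move=> f_inj dB; elim: r => [|i r IH] /=.
  rewrite muln0 mul1n muln1 -card_bool -card_ffun -cardsT.
  by apply/subset_leq_card/subsetP => w; rewrite !inE.
set A := [set w | all _ r] in IH.
pose E := [set w : {ffun T -> bool} | [ffun s => w (f i s)] \in B].
have dE : down_closed E.
  by move=> v w vw; rewrite !inE; apply: dB => s; rewrite !ffunE; apply: vw.
have dA : down_closed A.
  move=> v w vw; rewrite !inE => /allP wA; apply/allP => j jr.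
  by apply: dB (wA j jr) => s; rewrite !ffunE; apply: vw.
have -> : [set w : {ffun T -> bool} |
    ([ffun s => w (f i s)] \in B) && all (fun i => [ffun s => w (f i s)] \in B) r]
    = E :&: A by apply/setP => w; rewrite !inE.
have h1 := card_pullback _ _ _ B (f_inj i); rewrite -/E in h1.
have h2 := harris _ _ _ dE dA.
rewrite expnS mulnS expnD.
move: (expn_gt0 2 #|T|) IH h1 h2 => /=.
move: (2 ^ #|T|) (2 ^ (_ * _)) (2 ^ #|S|) (#|B| ^ _) => t u s c t0.
move: #|B| #|E| #|A| #|E :&: A| => b e a ea h0 h1 h2.
(* The product of [h1] and [IH] carries [t] twice, and [h2] costs one more factor [t]; the goal is
   scaled by [t] to match. *)
rewrite -(leq_pmul2r t0).
have : b * t * (c * t) <= e * s * (a * u) by apply: leq_mul.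
have : e * a * (s * u) <= ea * t * (s * u) by rewrite leq_mul2r h2 orbT.
lia.
Qed.

(* The axis-parallel line in direction [l.1] whose other coordinates are [l.2]. *)
Definition line {d n} (l : 'I_d.+1 * {ffun 'I_d -> 'I_n}) (s : site 1 n) :
    site d.+1 n :=
  [ffun i => if unlift l.1 i is Some h then l.2 h else s ord0].

Lemma line_inj d n (l : 'I_d.+1 * {ffun 'I_d -> 'I_n}) : injective (line l).
Proof.
move=> s s' /ffunP/(_ l.1); rewrite !ffunE unlift_none => e.
by apply/ffunP => i; rewrite ord1.
Qed.

Lemma shift_line d n (l : 'I_d.+1 * {ffun 'I_d -> 'I_n}) (s : site 1 n) t :
  Defs.shift (line l s) l.1 t = line l (Defs.shift s ord0 t).
Proof.
apply/ffunP => i; rewrite !ffunE.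
by case: unliftP => [h ->|->]; rewrite ?eqxx // eq_sym (negPf (neq_lift _ _)).
Qed.

Lemma subword_line d n (w : array d.+1 n) (l : 'I_d.+1 * {ffun 'I_d -> 'I_n})
    (s : site 1 n) m :
  subword w (line l s) m l.1 = subword [ffun s => w (line l s)] s m ord0.
Proof. by apply: eq_map => t; rewrite ffunE shift_line. Qed.

(** The lines in direction [j] partition the sites, and a word read along [j] never leaves its line,
    even when it wraps around. *)
Lemma card_subword_lines d n (w : array d.+1 n) (tau : seq bool) (j : 'I_d.+1) :
  #|[set x | subword w x (size tau) j == tau]| =
  \sum_(g : {ffun 'I_d -> 'I_n})
    #|[set s | subword [ffun s => w (line (j, g) s)] s (size tau) ord0 == tau]|.
Proof.
pose off (x : site d.+1 n) : {ffun 'I_d -> 'I_n} := [ffun h => x (lift j h)].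
rewrite -sum1_card (partition_big off xpredT) //=; apply: eq_bigr => g _.
rewrite sum1_card -(card_imset _ (@line_inj _ _ (j, g))); apply: eq_card => x.
rewrite unfold_in inE; apply/andP/imsetP => [[xw /eqP <-]|[s + ->]].
  have xE : x = line (j, off x) [ffun => x j].
    by apply/ffunP => i; rewrite !ffunE /=; case: unliftP => [h|] ->; rewrite ?ffunE.
  exists [ffun => x j] => //; rewrite inE.
  by rewrite -(subword_line _ _ w (j, off x)) -xE.
rewrite inE -(subword_line _ _ w (j, g)) => ->; split=> //.
by apply/eqP/ffunP => h; rewrite !ffunE liftK.
Qed.

Lemma Bcyc_down_closed (R : realType) D k (p : R) n : down_closed (Bcyc D k p n).
Proof.
move=> v w vw; rewrite !inE; apply: le_trans.
rewrite ler_wpM2r ?invr_ge0 ?ler0n // ler_nat.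
apply: leq_sum => j _; apply/subset_leq_card/subsetP => x; rewrite !inE size_nseq.
move=> /eqP vE; apply/eqP/(@eq_from_nth _ false); rewrite ?size_mkseq ?size_nseq // => t tk.
have := congr1 (nth false ^~ t) vE.
by rewrite !nth_mkseq // nth_nseq tk => /vw.
Qed.

(** With side N = [n.+1], there are [d.+1] * N^d lines, each with at most p N / [d.+1] occurrences,
    hence at most p N^[d.+1] in total. *)
Lemma Bcyc_lines (R : realType) d n k (p : R) (w : array d.+1 n.+1) :
  (forall l, [ffun s => w (line l s)] \in Bcyc 1 k (p / d.+1%:R)%R n.+1) ->
  w \in Bcyc d.+1 k p n.+1.
Proof.
move=> wB; rewrite inE /Tcyc.
under eq_bigr => j _ do rewrite card_subword_lines.
rewrite ler_pdivrMr ?ltr0n ?expn_gt0 // pair_big /= natr_sum.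
have lineP (l : 'I_d.+1 * {ffun 'I_d -> 'I_n.+1}) : true ->
    (#|[set s | subword [ffun s => w (line (l.1, l.2) s)] s k.+1 ord0
          == nseq k.+1 true]|%:R <= p / d.+1%:R * n.+1%:R :> R)%R.
  move=> _; case: l => j g; have := wB (j, g).
  by rewrite inE /Tcyc big_ord1 size_nseq expn1 ler_pdivrMr ?ltr0n.
rewrite size_nseq (le_trans (ler_sum _ lineP)) // sumr_const.
rewrite card_prod card_ffun !card_ord -[X in (X <= _)%R]mulr_natr natrM expnS natrM.
set N := (_ ^ _)%:R%R.
by rewrite mulrACA mulrA divfK ?pnatr_eq0 // mulrA.
Qed.

Lemma card_Bcyc_lines (R : realType) d n k (p : R) :
  #|Bcyc 1 k (p / d.+1%:R)%R n.+1| ^ (d.+1 * n.+1 ^ d) * 2 ^ (n.+1 ^ d.+1)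
    <= #|Bcyc d.+1 k p n.+1| * 2 ^ (n.+1 * (d.+1 * n.+1 ^ d)).
Proof.
set B := Bcyc 1 k _ _.
have := card_pullbacks _ _ _ (enum {: 'I_d.+1 * {ffun 'I_d -> 'I_n.+1}}) line B
  (@line_inj d n.+1) (Bcyc_down_closed _ _ _ _ _).
rewrite -cardE card_prod !card_ffun !card_ord expn1 => /leq_trans; apply.
rewrite leq_mul2r; apply/orP; right.
apply/subset_leq_card/subsetP => w; rewrite inE => /allP wB.
by apply: Bcyc_lines => l; apply: wB; rewrite mem_enum.
Qed.

Lemma Bcyc_gt0 (R : realType) D k (p : R) n : (0 <= p)%R -> 0 < #|Bcyc D k p n|.
Proof.
move=> p0; apply/card_gt0P; exists [ffun=> false]; rewrite inE /Tcyc.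
rewrite big1 ?mul0r // => j _; apply/eqP; rewrite cards_eq0; apply/eqP/setP => x.
by rewrite !inE size_nseq /subword /mkseq /= ffunE eqseq_cons andFb.
Qed.

(** Take logarithms in [card_Bcyc_lines] and divide by the number of sites; the ratio of lines to
    sites is [d.+1 / n.+1]. *)
Lemma log2_card_Bcyc (R : realType) d n k (p : R) : (0 <= p)%R ->
  (1 + d.+1%:R *
     (log2 #|Bcyc 1 k (p / d.+1%:R)%R n.+1|%:R / (n.+1 ^ 1)%:R - 1)
   <= log2 #|Bcyc d.+1 k p n.+1|%:R / (n.+1 ^ d.+1)%:R :> R)%R.
Proof.
move=> p0; have := card_Bcyc_lines R d n k p.
have := Bcyc_gt0 _ d.+1 k _ n.+1 p0.
have : 0 < #|Bcyc 1 k (p / d.+1%:R)%R n.+1|.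
  by apply: Bcyc_gt0; rewrite divr_ge0.
move: #|Bcyc 1 k _ _| #|Bcyc d.+1 k p _| => b c b0 c0.
rewrite -(ler_nat R) => H; rewrite 2!natrM !natrX in H.
have {H} : (ln (b%:R ^+ (d.+1 * n.+1 ^ d) * 2 ^+ (n.+1 ^ d.+1))
    <= ln (c%:R * 2 ^+ (n.+1 * (d.+1 * n.+1 ^ d))) :> R)%R.
  by rewrite ler_ln ?posrE ?mulr_gt0 ?exprn_gt0 ?ltr0n.
have lnX (x : R) m : (0 < x -> ln (x ^+ m) = ln x * m%:R)%R.
  by move=> x0; rewrite lnXn // mulr_natr.
rewrite !lnM ?posrE ?exprn_gt0 ?ltr0n // !lnX ?ltr0n // => H.
have l2 : (0 < ln 2 :> R)%R by rewrite ln_gt0 // ltr1n.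
rewrite /log2; move: (ln b%:R)%R (ln c%:R)%R (ln 2)%R l2 H => {b0 c0} {}b {}c l l2.
rewrite expn1 expnS !natrM natrX.
set N := (n.+1%:R : R)%R; set M := (N ^+ d)%R; set e := (d.+1%:R : R)%R => H.
have N0 : (0 < N)%R by rewrite ltr0n.
have M0 : (0 < M)%R by rewrite exprn_gt0.
rewrite -subr_ge0.
(* The numerator is exactly the slack in [H]. *)
have -> : (c / l / (N * M) - (1 + e * (b / l / N - 1)) =
  (c + l * (N * (e * M)) - (b * (e * M) + l * (N * M))) / (l * (N * M)))%R.
  by field; rewrite !gt_eqF.
by rewrite divr_ge0 ?subr_ge0 // ltW // !mulr_gt0.
Qed.

Lemma limn_esup_affine (R : realType) (u v : (\bar R)^nat) (c : R) : (0 < c)%R ->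
  (forall n, 1 + c%:E * (u n.+1 - 1) <= v n.+1)%E ->
  (1 + c%:E * (limn_esup u - 1) <= limn_esup v)%E.
Proof.
move=> c0 uv; rewrite !limn_esup_lim.
(* Inverting the affine map isolates [x], so that a bound on a supremum [x] can be checked term by
   term. *)
have affine_le (x y : \bar R) :
    (1 + c%:E * (x - 1) <= y = (x <= c^-1%:E * (y - 1) + 1))%E.
  by rewrite -leeBlDr // lee_pdivlMl // leeBrDl.
have cv : ((fun n => 1 + c%:E * (esups u n - 1))%E @ \oo -->
    (1 + c%:E * (limn (esups u) - 1))%E)%classic.
  apply: cvgeD; [exact: fin_num_adde_defr|exact: cvg_cst|].
  apply: cvgeZl => //.
  apply: cvgeD; [exact: fin_num_adde_defl| |exact: cvg_cst].
  exact: is_cvg_esups.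
rewrite -(cvg_lim _ cv) //; apply: lee_lim.
- by apply/cvg_ex; eexists; exact: cv.
- exact: is_cvg_esups.
(* Tails start at index 1, because the hypothesis compares the sequences only at successors. *)
exists 1%N => // n /= n0; rewrite affine_le; apply/ereal_supP => _ [m /= nm <-].
rewrite -affine_le; case: m nm => [|m nm]; first by rewrite leqNgt n0.
by apply: le_trans (uv m) _; apply: ereal_sup_ubound; exists m.+1.
Qed.

Local Open Scope ring_scope.
Local Open Scope ereal_scope.

Theorem theorem31 (R : realType) (D k : nat) (p : R)
    (hD : (1 <= D)%N) (hk : (1 <= k)%N) (hp0 : (0 <= p)%R) (hp1 : (p <= 1)%R) :
  1 + D%:R%:E * (capacity 1 k (p / D%:R)%R - 1) <= capacity D k p.
Proof.
case: D hD => // d _; apply: limn_esup_affine => [|n]; first by rewrite ltr0n.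
by rewrite -EFinB -EFinM -EFinD lee_fin log2_card_Bcyc.
Qed.
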